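(* (i) For each $\alpha\in\{-z: z=13,15,17,20,35,36,37,39,41,42,43,44,46,48,52\}$ there exists a singly-even binary self-dual $[56,28,10]$ code whose weight enumerator is of the form $$W_{56,1}=1+(308+4\alpha)x^{10}+(4246-8\alpha)x^{12}+\cdots.$$ (ii) For each $\alpha\in\{-z: z=1,3,33,36,37,39,41,43,44,45,46,47,48,49\}$ there exists a singly-even binary self-dual $[56,28,10]$ code whose weight enumerator is of the form $$W_{56,2}=1+(308+4\alpha)x^{10}+(3990-8\alpha)x^{12}+\cdots.$$
   Context: A binary $[n,k,d]$ code is a $k$-dimensional linear subspace of $\mathbb{F}_2^n$ with minimum Hamming distance $d$. It is self-dual if it equals its dual with respect to the Euclidean inner product $\langle\mathbf{x},\mathbf{y}\rangle=\sum_i x_iy_i$. A binary self-dual code is singly-even (Type I) if not all of its codeword weights are divisible by 4. The weight enumerator is $\sum_i A_i x^i$, where $A_i$ is the number of codewords of Hamming weight $i$; in the displayed forms, $\cdots$ stands for terms of higher degree, so the forms specify the coefficients of all powers of $x$ up to $x^{12}$. *)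

(* Defs.v *)
From mathcomp Require Import all_boot all_order all_algebra.

Set Implicit Arguments.
Unset Strict Implicit.
Unset Printing Implicit Defensive.

Import GRing.Theory.

Local Open Scope ring_scope.

Definition hamming_dist n (x y : 'rV['F_2]_n) : nat :=
  #|[set i | x 0 i != y 0 i]|.

Definition hamming_weight n (x : 'rV['F_2]_n) : nat :=
  #|[set i | x 0 i != 0]|.

Definition minimum_distance n (C : {vspace 'rV['F_2]_n}) (d : nat) : Prop :=
  (exists x y, [/\ x \in C, y \in C, x != y & hamming_dist x y = d]) /\
  (forall x y, x \in C -> y \in C -> x != y -> (d <= hamming_dist x y)%N).

Definition is_code n (k d : nat) (C : {vspace 'rV['F_2]_n}) : Prop :=
  \dim C = k /\ minimum_distance C d.

Definition inner_product n (x y : 'rV['F_2]_n) : 'F_2 :=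
  \sum_(i < n) x 0 i * y 0 i.

Definition dual_code n (C : {vspace 'rV['F_2]_n}) : {set 'rV['F_2]_n} :=
  [set x | [forall (y | y \in C), inner_product x y == 0]].

Definition self_dual n (C : {vspace 'rV['F_2]_n}) : Prop :=
  [set x | x \in C] = dual_code C.

Definition singly_even n (C : {vspace 'rV['F_2]_n}) : Prop :=
  exists2 x, x \in C & ~~ (4 %| hamming_weight x)%N.

Definition weight_count n (C : {vspace 'rV['F_2]_n}) (i : nat) : nat :=
  #|[set x | (x \in C) && (hamming_weight x == i)]|.

(* Integer coefficients, since the prescribed ones involve a negative
   parameter. *)
Definition weight_enumerator n (C : {vspace 'rV['F_2]_n}) : {poly int} :=
  \sum_(i < n.+1) (weight_count C i)%:R *: 'X^i.

(* take_poly 13 keeps exactly the terms of degree at most 12; the terms of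
   higher degree are unconstrained. *)
Definition W56_1_form (alpha : int) (W : {poly int}) : Prop :=
  take_poly 13 W =
    1 + (308 + 4 * alpha) *: 'X^10 + (4246 - 8 * alpha) *: 'X^12.

Definition W56_2_form (alpha : int) (W : {poly int}) : Prop :=
  take_poly 13 W =
    1 + (308 + 4 * alpha) *: 'X^10 + (3990 - 8 * alpha) *: 'X^12.

(* Main.v *)
Require Import Defs.
From Stdlib Require Import ZArith.
From mathcomp Require Import all_boot all_order all_algebra ssrZ zify ring.

(* Each code C is given by a generator matrix [I | A] with A A^T = I, found by a
   computer search through neighbours of self-dual codes.  Let S be its shadow,
   the set of all x with <x, c> = wt(c)/2 mod 2 for every c in C.  Only vectors
   of weight at most 8 need to be enumerated: if C has no nonzero codeword of
   weight at most 8 and S has b4 and b8 vectors of weights 4 and 8 and does not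
   contain 0, then MacWilliams' identity together with its analogue for S forces
     A_10 = 308 - 4 (b8 + 12 b4),  A_12 = 3990 + 256 b4 + 8 (b8 + 12 b4),
   so that alpha = - (b8 + 12 b4), and the forms W_{56,1} and W_{56,2}
   correspond to b4 = 1 and b4 = 0. *)

Set Implicit Arguments.
Unset Strict Implicit.
Unset Printing Implicit Defensive.

Import GRing.Theory.
Local Open Scope ring_scope.
(* MathComp binds the key Z to int_scope. *)
Local Delimit Scope Z_scope with coqZ.

(** * Binary words and vectors over F_2 *)

Local Notation wt := (count id).

Fixpoint xorw (x y : bitseq) : bitseq :=
  match x, y with
  | a :: x', b :: y' => (a (+) b) :: xorw x' y'
  | _, _ => [::]
  end.

Fixpoint dotw (x y : bitseq) : bool :=
  match x, y with
  | a :: x', b :: y' => (a && b) (+) dotw x' y'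
  | _, _ => false
  end.

Fixpoint words (n : nat) : seq bitseq :=
  if n is m.+1 then map (cons false) (words m) ++ map (cons true) (words m)
  else [:: [::]].

Definition rv n (b : bitseq) : 'rV['F_2]_n := \row_j (nth false b j)%:R.

(** This is x + u A for the matrix A with the given rows. The accumulator [x] matches the partial
    sums carried by the enumeration below. *)
Fixpoint comb (rows : seq bitseq) (x u : bitseq) : bitseq :=
  match rows, u with
  | r :: rows', b :: u' => comb rows' (if b then xorw r x else x) u'
  | _, _ => x
  end.

Lemma size_xorw x y : size (xorw x y) = minn (size x) (size y).
Proof. by elim: x y => [|a x IH] [|b y] //=; rewrite IH minnSS. Qed.

Lemma mem_words n b : (b \in words n) = (size b == n).
Proof.
elim: n b => [|n IH] [|a b] //=.
  by rewrite mem_cat; apply/negbTE/norP; split; apply/mapP => -[].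
rewrite eqSS -IH mem_cat; case: a.
  rewrite mem_map; last by move=> ? ? [].
  by rewrite orbC; case: (b \in _) => //=; apply/mapP => -[].
rewrite mem_map; last by move=> ? ? [].
by case: (b \in _) => //=; apply/mapP => -[].
Qed.

Lemma uniq_words n : uniq (words n).
Proof.
elim: n => //= n IH; rewrite cat_uniq !map_inj_uniq ?IH; try by move=> ? ? [].
by rewrite andbT; apply/hasPn => _ /mapP[y _ ->]; apply/mapP => -[].
Qed.

Lemma natF2_inj : injective (fun b : bool => b%:R : 'F_2).
Proof. by case; case. Qed.

Lemma natF2_addb (a b : bool) : (a (+) b)%:R = a%:R + b%:R :> 'F_2.
Proof. by apply/eqP; case: a; case: b. Qed.

Lemma natF2_andb (a b : bool) : (a && b)%:R = a%:R * b%:R :> 'F_2.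
Proof. by apply/eqP; case: a; case: b. Qed.

Lemma F2_natE (a : 'F_2) : a = (a != 0)%:R.
Proof. by case: a => [[|[|//]] ?]; apply/val_inj. Qed.

Lemma rv_inj n : {in words n &, injective (rv n)}.
Proof.
move=> x y; rewrite !mem_words => /eqP sx /eqP sy exy.
apply: (@eq_from_nth _ false) => [|i]; first by rewrite sx.
rewrite sx => lt_in; have /rowP/(_ (Ordinal lt_in)) := exy.
by rewrite !mxE => /natF2_inj.
Qed.

Lemma rv_surj n (x : 'rV_n) : exists2 b, size b = n & x = rv n b.
Proof.
exists [seq x 0 i != 0 | i <- enum 'I_n].
  by rewrite size_map size_enum_ord.
apply/rowP => i; rewrite mxE (nth_map i) ?size_enum_ord //.
by rewrite nth_ord_enum -F2_natE.
Qed.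

(** Moves sums over vectors to explicit lists of boolean words, where induction on the length and
    evaluation are possible. *)
Lemma big_rv (V : nmodType) n (F : 'rV['F_2]_n -> V) :
  \sum_x F x = \sum_(b <- words n) F (rv n b).
Proof.
rewrite -(big_map (rv n) xpredT) /=; apply: perm_big.
apply: uniq_perm; rewrite ?index_enum_uniq //.
  by rewrite map_inj_in_uniq ?uniq_words //; apply: rv_inj.
move=> x; rewrite mem_index_enum; apply/esym/mapP.
by have [b /eqP sb ->] := rv_surj x; exists b; rewrite ?mem_words.
Qed.

Lemma card_rv n (P : pred 'rV['F_2]_n) :
  #|[set x | P x]| = count (P \o rv n) (words n).
Proof.
rewrite cardsE -sum1_card big_mkcond (big_rv (fun x => if x \in P then 1 else 0)%N).
by rewrite -big_mkcond sum1_count.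
Qed.

Lemma hamming_weight_rv n b : size b = n -> hamming_weight (rv n b) = wt b.
Proof.
move=> <-; rewrite /hamming_weight cardsE -sum1_card -sum1_count (big_nth false).
rewrite big_mkord; apply: eq_bigl => i.
by rewrite unfold_in mxE; case: nth.
Qed.

Lemma rv_xorw n x y : size x = n -> size y = n ->
  rv n (xorw x y) = rv n x + rv n y.
Proof.
move=> sx sy; apply/rowP => i; rewrite !mxE -natF2_addb; congr (nat_of_bool _)%:R.
have: (i < size x)%N by rewrite sx.
have: size x = size y by rewrite sx sy.
elim: x y (nat_of_ord i) {sx sy} => [|a x IH] [|b y] [|j] //= [sxy].
exact: IH.
Qed.

Lemma inner_product_rv n x y : size x = n -> size y = n ->
  inner_product (rv n x) (rv n y) = (dotw x y)%:R.
Proof.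
move=> <-; rewrite /inner_product; elim: x y => [|a x IH] [|b y] //= => [_|[sxy]].
  by rewrite big_ord0.
rewrite big_ord_recl natF2_addb natF2_andb !mxE -IH //.
by congr (_ + _); apply: eq_bigr => i _; rewrite !mxE.
Qed.

Definition rows_mx m n (rows : seq bitseq) : 'M['F_2]_(m, n) :=
  \matrix_(i, j) (nth false (nth [::] rows i) j)%:R.

Lemma rv_comb m n rows x u :
  size rows = m -> all (fun r => size r == n) rows -> size x = n -> size u = m ->
  rv n (comb rows x u) = rv n x + rv m u *m rows_mx m n rows.
Proof.
move=> <- {m}; rewrite mulmx_sum_row; elim: rows x u => [|r rows IH] x [|b u] //=.
  by rewrite big_ord0 addr0.
case/andP=> /eqP sr srows sx [su]; rewrite IH //; last first.
  by case: b; rewrite ?size_xorw ?sr ?sx ?minnn.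
rewrite big_ord_recl addrA; congr (_ + _); last first.
  by apply: eq_bigr => i _; rewrite !mxE; congr (_ *: _); apply/rowP => j; rewrite !mxE.
rewrite mxE /=; case: b; rewrite ?rv_xorw // ?scale1r ?scale0r ?addr0 // addrC.
by congr (_ + _); apply/rowP => j; rewrite !mxE.
Qed.

Lemma size_comb n rows x u :
  all (fun r => size r == n) rows -> size x = n -> size (comb rows x u) = n.
Proof.
elim: rows x u => [|r rows IH] x [|b u] //= /andP[/eqP sr srows] sx.
by rewrite IH //; case: b; rewrite ?size_xorw ?sr ?sx ?minnn.
Qed.

(** * Enumeration of light vectors *)

(** Stops at the one that exceeds the budget [b], so heavy words are rejected without being read to
    the end. *)
Fixpoint wt_le (x : bitseq) (b : nat) : bool :=
  match x with
  | [::] => true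
  | false :: x' => wt_le x' b
  | true :: x' => if b is b'.+1 then wt_le x' b' else false
  end.

Definition leaf (x : bitseq) (k : nat) : seq (nat * nat) :=
  if wt_le x (8 - k) then [:: (k, wt x)] else [::].

(* The pairs (k + wt u, wt (x + u A)) with wt u <= t and total at most 8, where
   A has the given rows and [x] already includes k of the rows above them. *)
Fixpoint light (rows : seq bitseq) (x : bitseq) (k t : nat) : seq (nat * nat) :=
  match t, rows with
  | t'.+1, r :: rows' =>
      light rows' x k t ++ light rows' (xorw r x) k.+1 t'
  | _, _ => leaf x k
  end.

Lemma wt_leE x b : wt_le x b = (wt x <= b)%N.
Proof. by elim: x b => [|[] x IH] [|b] //=; rewrite IH. Qed.

Lemma filter_words0 n (P : pred bitseq) :
  [seq u <- words n | (wt u <= 0)%N && P u] =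
  if P (nseq n false) then [:: nseq n false] else [::].
Proof.
elim: n P => [|n IH] P /=; first by case: (P _).
rewrite filter_cat !filter_map /= (eq_filter (a2 := fun u => (wt u <= 0)%N && P (false :: u))) //.
rewrite IH (eq_filter (a2 := pred0)) ?filter_pred0 ?cats0; last by move.
by case: ifP.
Qed.

Lemma comb_nseq0 rows x n : comb rows x (nseq n false) = x.
Proof. by elim: rows n => [|r rows IH] [|n] //=. Qed.

Lemma wt_nseq0 n : wt (nseq n false) = 0%N.
Proof. by rewrite count_nseq. Qed.

(** Induction on the rows, splitting on the first bit of [u]. The hypothesis keeps k at most 8 along
    every branch, so the truncated subtraction [8 - k] in [leaf] is exact. *)
Lemma lightE rows x k t : (k + t <= 8)%N ->
  light rows x k t =
  [seq (k + wt u, wt (comb rows x u))%N | u <- words (size rows)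
     & (wt u <= t)%N && (k + wt u + wt (comb rows x u) <= 8)%N].
Proof.
elim: rows x k t => [|r rows IH] x k t kt8.
  have ->: light [::] x k t = leaf x k by case: t {kt8}.
  rewrite /= addn0 /leaf wt_leE leq_subRL; last by lia.
  by case: ifP; rewrite //= addn0.
case: t kt8 => [|t] kt8.
  (* With no budget left only the zero word qualifies, which is why [light] may stop with rows
     remaining. *)
  rewrite filter_words0 comb_nseq0 wt_nseq0 addn0 /= /leaf wt_leE leq_subRL; last by lia.
  by case: ifP; rewrite //= ?comb_nseq0 ?wt_nseq0 ?addn0.
rewrite /= !IH; try lia.
rewrite filter_cat map_cat !filter_map -!map_comp; congr (_ ++ _).
rewrite (eq_filter (a2 := fun u => (wt u <= t)%N &&
   (k.+1 + wt u + wt (comb rows (xorw r x) u) <= 8)%N)); last first.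
  by move=> u /=; rewrite add1n ltnS addSnnS.
by apply: eq_map => u /=; rewrite add1n addSnnS.
Qed.

(** * Characters and Krawtchouk transforms *)

Definition chi (a : 'F_2) : Z := (-1) ^+ (a != 0).

Lemma chi_nat (b : bool) : chi b%:R = (-1) ^+ b.
Proof. by case: b. Qed.

Lemma chiD : {morph chi : a b / a + b >-> a * b}.
Proof.
move=> a b; rewrite (F2_natE a) (F2_natE b) -natF2_addb !chi_nat.
by case: (a != 0); case: (b != 0).
Qed.

(* A list [f] stands for the functional z^j |-> f_j on polynomials; [step] is
   the adjoint of multiplication by [1 + z] or [1 - z], so [krawtchouk f n i]
   is the value of [f] at (1 - z)^i (1 + z)^(n - i). *)
Fixpoint step (e : bool) (f : seq Z) : seq Z :=
  if f is a :: f' then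
    (if e then Z.sub else Z.add) a (head 0 f') :: step e f'
  else [::].

Definition krawtchouk (f : seq Z) (n i : nat) : Z :=
  head 0 (iter i (step true) (iter (n - i) (step false) f)).

Lemma size_step e f : size (step e f) = size f.
Proof. by elim: f => //= a f ->. Qed.

(** The list [f] is understood as extended by zeros: the default 0 makes the formula valid also at
    and beyond the last index. *)
Lemma nth_step e f j :
  nth 0 (step e f) j = nth 0 f j + (-1) ^+ e * nth 0 f j.+1.
Proof.
elim: f j => [|a f IH] j /=; first by rewrite !nth_nil mulr0 addr0.
case: j => [|j] //=; rewrite nth0.
by case: e {IH}; rewrite ?expr1 ?mulN1r ?mul1r.
Qed.

Lemma stepC a b f : step a (step b f) = step b (step a f).
Proof.
apply: (@eq_from_nth _ 0) => [|i _]; first by rewrite !size_step.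
rewrite !nth_step; ring.
Qed.

Lemma iter_stepC a b n f :
  iter n (step a) (step b f) = step b (iter n (step a) f).
Proof. by elim: n => //= n ->; rewrite stepC. Qed.

(** The signed sum of z^(wt x) over all x factors over coordinates into terms 1 + z or 1 - z
    according to the bits of [c]; the adjoint steps commute, so only the weight of [c] matters. *)
Lemma sum_words_sign c f :
  \sum_(x <- words (size c)) (-1) ^+ dotw c x * nth 0 f (wt x) =
  krawtchouk f (size c) (wt c).
Proof.
rewrite /krawtchouk; elim: c f => [|b c IH] f /=.
  by rewrite big_seq1 mul1r nth0.
rewrite big_cat !big_map /= -big_split /=.
transitivity (\sum_(x <- words (size c))
                (-1) ^+ dotw c x * nth 0 (step b f) (wt x)).
  apply: eq_bigr => x _; rewrite nth_step !andbF andbT addFb signr_addb /=.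
  rewrite add0n add1n; ring.
rewrite IH; case: b => /=.
  by rewrite add1n subSS iter_stepC -iterSr.
by rewrite add0n subSn ?count_size // -iterSr.
Qed.

Lemma sum_chi_weight n (c : 'rV['F_2]_n) f :
  \sum_x chi (inner_product c x) * nth 0 f (hamming_weight x) =
  krawtchouk f n (hamming_weight c).
Proof.
have [b sb ->] := rv_surj c; rewrite big_rv hamming_weight_rv //.
rewrite -[in RHS]sb -sum_words_sign sb; apply: eq_big_seq => x.
rewrite mem_words => /eqP sx.
by rewrite inner_product_rv // chi_nat hamming_weight_rv.
Qed.

(** * Bilinearity, character orthogonality and weights of sums *)

Lemma inner_productE n (x y : 'rV['F_2]_n) : inner_product x y = (x *m y^T) 0 0.
Proof. by rewrite mxE; apply: eq_bigr => i _; rewrite mxE. Qed.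

Lemma inner_productC n (x y : 'rV['F_2]_n) :
  inner_product x y = inner_product y x.
Proof. by apply: eq_bigr => i _; rewrite mulrC. Qed.

Lemma inner_productDl n (x y z : 'rV['F_2]_n) :
  inner_product (x + y) z = inner_product x z + inner_product y z.
Proof. by rewrite !inner_productE mulmxDl mxE. Qed.

Lemma inner_productDr n (x y z : 'rV['F_2]_n) :
  inner_product x (y + z) = inner_product x y + inner_product x z.
Proof. by rewrite inner_productC inner_productDl !(inner_productC x). Qed.

Lemma inner_product0l n (x : 'rV['F_2]_n) : inner_product 0 x = 0.
Proof. by rewrite inner_productE mul0mx mxE. Qed.

Lemma inner_product_row m n (a c : 'rV['F_2]_m) (b d : 'rV['F_2]_n) :
  inner_product (row_mx a b) (row_mx c d) = inner_product a c + inner_product b d.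
Proof. by rewrite !inner_productE tr_row_mx mul_row_col mxE. Qed.

Lemma inner_product_mulmx m n (a : 'rV['F_2]_m) (u : 'rV['F_2]_n) A :
  inner_product a (u *m A) = inner_product (a *m A^T) u.
Proof. by rewrite !inner_productE trmx_mul mulmxA. Qed.

Lemma inner_product_delta n (x : 'rV['F_2]_n) i :
  inner_product x (delta_mx 0 i) = x 0 i.
Proof.
rewrite /inner_product (bigD1 i) //= mxE !eqxx mulr1 big1 ?addr0 // => j ji.
by rewrite mxE (negPf ji) mulr0.
Qed.

Lemma oppF2 (a : 'F_2) : - a = a.
Proof. by apply/eqP; case: a => [[|[|//]] ?]. Qed.

Lemma opp_rv n (x : 'rV['F_2]_n) : - x = x.
Proof. by apply/rowP => i; rewrite mxE oppF2. Qed.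

Lemma add_rvv n (x : 'rV['F_2]_n) : x + x = 0.
Proof. by rewrite -{2}(opp_rv x) subrr. Qed.

(** Orthogonality of characters: if v_i is nonzero, translating [u] by the unit vector e_i negates
    the sum. *)
Lemma sum_chi n (v : 'rV['F_2]_n) :
  \sum_u chi (inner_product v u) = if v == 0 then 2 ^+ n else 0.
Proof.
case: eqVneq => [->|/rV0Pn[i vi]].
  under eq_bigr => u _ do rewrite inner_product0l (chi_nat false) expr0.
  by rewrite sumr_const card_mx card_Fp // mul1n natrX.
set S := LHS; suff: S = - S by lia.
rewrite {1}/S (reindex_inj (addIr (delta_mx 0 i))) -sumrN.
apply: eq_bigr => u _; rewrite inner_productDr inner_product_delta chiD.
by rewrite (F2_natE (v 0 i)) vi chi_nat mulrN1.
Qed.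

Lemma natF2E k : k%:R = (odd k)%:R :> 'F_2.
Proof.
rewrite -{1}[k]odd_double_half -muln2 natrD natrM.
by rewrite (_ : 2%:R = 0) ?mulr0 ?addr0 //; apply/val_inj.
Qed.

Lemma hamming_weightE n (x : 'rV['F_2]_n) :
  hamming_weight x = (\sum_i (x 0%R i != 0%R))%N.
Proof. by rewrite /hamming_weight cardsE -sum1_card big_mkcond. Qed.

Lemma inner_product_self n (x : 'rV['F_2]_n) :
  inner_product x x = (odd (hamming_weight x))%:R.
Proof.
rewrite -natF2E hamming_weightE natr_sum; apply: eq_bigr => i _.
by rewrite {1 2}(F2_natE (x 0 i)); case: (x 0 i != 0); rewrite ?mulr1 ?mulr0.
Qed.

(** The witness k is the size of the common support, whose parity is the inner product. *)
Lemma hamming_weightD n (x y : 'rV['F_2]_n) :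
  exists2 k, inner_product x y = k%:R &
  (hamming_weight (x + y) + k.*2 = hamming_weight x + hamming_weight y)%N.
Proof.
exists (\sum_i ((x 0%R i != 0%R) && (y 0%R i != 0%R)))%N.
  rewrite natr_sum; apply: eq_bigr => i _.
  by rewrite natF2_andb -!F2_natE.
rewrite !hamming_weightE -muln2 big_distrl -!big_split /=.
apply: eq_bigr => i _; rewrite mxE (F2_natE (x 0 i)) (F2_natE (y 0 i)) -natF2_addb.
by case: (x 0 i != 0); case: (y 0 i != 0).
Qed.

(** Orthogonality makes the overlap k even, so the correction 2k to the weight is divisible by 4.
    Hence wt/2 mod 2 is additive on a self-orthogonal code. *)
Lemma odd_half_weightD n (x y : 'rV['F_2]_n) :
  ~~ odd (hamming_weight x) -> ~~ odd (hamming_weight y) ->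
  inner_product x y = 0 ->
  odd (hamming_weight (x + y))./2 =
  odd (hamming_weight x)./2 (+) odd (hamming_weight y)./2.
Proof.
have [k -> hk] := hamming_weightD x y.
rewrite natF2E => ex ey /(@natF2_inj _ false) ok.
have := odd_double_half k; rewrite ok add0n => {ok}ek.
have := even_halfK ex; have := even_halfK ey => {ex} hy {ey} hx.
have -> : (hamming_weight (x + y) =
  (hamming_weight x)./2.*2 + (hamming_weight y)./2.*2 - k./2.*2.*2)%N by lia.
rewrite -!doubleD -doubleB doubleK oddB ?oddD ?odd_double ?addbF //; lia.
Qed.

Lemma hamming_weight_row m n (a : 'rV['F_2]_m) (b : 'rV['F_2]_n) :
  hamming_weight (row_mx a b) = (hamming_weight a + hamming_weight b)%N.
Proof.
rewrite !hamming_weightE big_split_ord /=.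
by congr (_ + _)%N; apply: eq_bigr => i _; rewrite ?row_mxEl ?row_mxEr.
Qed.

Lemma hamming_weight0 n : hamming_weight (0 : 'rV['F_2]_n) = 0%N.
Proof. by rewrite hamming_weightE big1 // => i _; rewrite mxE eqxx. Qed.

Lemma hamming_weight_eq0 n (x : 'rV['F_2]_n) : (hamming_weight x == 0%N) = (x == 0).
Proof.
apply/idP/eqP => [|->]; last by rewrite hamming_weight0.
rewrite hamming_weightE sum_nat_eq0 => /forallP x0; apply/rowP => i.
by have := x0 i; rewrite mxE /= eqb0 negbK => /eqP.
Qed.

Lemma hamming_weight_delta n (i : 'I_n) :
  hamming_weight (delta_mx 0 i : 'rV['F_2]_n) = 1%N.
Proof.
rewrite hamming_weightE (bigD1 i) //= mxE !eqxx big1 // => j ji.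
by rewrite mxE (negPf ji).
Qed.

Lemma hamming_distE n (x y : 'rV['F_2]_n) :
  hamming_dist x y = hamming_weight (x + y).
Proof.
rewrite /hamming_dist /hamming_weight; congr #|pred_of_set _|.
by apply/setP => i; rewrite !inE mxE addr_eq0 oppF2.
Qed.

(** * Self-dual codes with generator matrix [I | A] *)

Section SystematicCode.

Variables (m : nat) (A : 'M['F_2]_m).

Definition codeword (u : 'rV['F_2]_m) : 'rV_(m + m) := row_mx u (u *m A).

Definition code : {vspace 'rV['F_2]_(m + m)} :=
  limg (linfun (mulmxr (row_mx 1%:M A))).

Lemma codewordD u v : codeword (u + v) = codeword u + codeword v.
Proof. by rewrite /codeword mulmxDl add_row_mx. Qed.

Lemma codeword0 : codeword 0 = 0.
Proof. by rewrite /codeword mul0mx row_mx0. Qed.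

Lemma codeword_inj : injective codeword.
Proof. by move=> u v /eq_row_mx[]. Qed.

Lemma mem_codeP x : reflect (exists u, x = codeword u) (x \in code).
Proof.
apply: (iffP memv_imgP) => [[u _ ->]|[u ->]]; exists u; rewrite ?memvf //;
  by rewrite lfunE /= mul_mx_row mulmx1.
Qed.

Lemma codeword_in u : codeword u \in code.
Proof. by apply/mem_codeP; exists u. Qed.

(** The identity block makes the encoding map injective. *)
Lemma dim_code : \dim code = m.
Proof.
rewrite /code limg_dim_eq ?dimvf /dim /= ?mul1n //.
apply/eqP; rewrite -subv0; apply/subvP => u.
rewrite memv_cap memv_ker lfunE /= mul_mx_row mulmx1 memv0 => /andP[_ /eqP].
by rewrite -(row_mx0 _ 1 m m) => /eq_row_mx[->].
Qed.

Lemma weight_count_code w :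
  weight_count code w = #|[set u | hamming_weight (codeword u) == w]|.
Proof.
rewrite -(card_imset _ codeword_inj) /weight_count; apply: eq_card => x.
rewrite inE; apply/andP/imsetP => [[/mem_codeP[u ->] wu]|[u]].
  by exists u; rewrite ?inE.
by rewrite inE => wu ->; split=> //; apply/mem_codeP; exists u.
Qed.

Lemma big_code (V : nmodType) (F : 'rV['F_2]_(m + m) -> V) :
  \sum_(y in code) F y = \sum_u F (codeword u).
Proof.
rewrite (eq_bigl [in [set codeword u | u in 'rV['F_2]_m]]) => [|y].
  by rewrite big_imset //; apply: in2W; apply: codeword_inj.
by apply/mem_codeP/imsetP => [[u ->]|[u _ ->]]; exists u.
Qed.

Hypothesis AAt : A *m A^T = 1%:M.

(** The vector paired with [u] on the right is the syndrome of [y], with [I | A] taken as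
    parity-check matrix. *)
Lemma inner_product_codeword y u :
  inner_product y (codeword u) = inner_product (lsubmx y + rsubmx y *m A^T) u.
Proof.
rewrite -{1}[y]hsubmxK inner_product_row inner_product_mulmx.
by rewrite inner_productDl.
Qed.

(** Over F_2 a zero syndrome means l = r A^T for the halves l, r of [y]. Since A^T A = I as well,
    this is r = l A, the equation of the code. *)
Lemma orthogonal_code y :
  (lsubmx y + rsubmx y *m A^T == 0) = (y \in code).
Proof.
apply/eqP/mem_codeP => [|[u ->]].
  rewrite addrC => /addr0_eq/esym; rewrite opp_rv => ly; exists (lsubmx y).
  by rewrite -{1}[y]hsubmxK /codeword ly -mulmxA (mulmx1C AAt) mulmx1.
by rewrite row_mxKl row_mxKr -mulmxA AAt mulmx1 add_rvv.
Qed.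

Lemma self_orthogonal u v : inner_product (codeword u) (codeword v) = 0.
Proof.
have /eqP cu0: lsubmx (codeword u) + rsubmx (codeword u) *m A^T == 0.
  by rewrite orthogonal_code codeword_in.
by rewrite inner_product_codeword cu0 inner_product0l.
Qed.

Lemma self_dual_code : self_dual code.
Proof.
apply/setP => x; rewrite !inE; apply/idP/forall_inP => [/mem_codeP[u ->] y|x0].
  by move=> /mem_codeP[v ->]; rewrite self_orthogonal.
rewrite -orthogonal_code; apply/eqP/rowP => i.
(* Pairing with the i-th generator reads off the i-th coordinate of the syndrome. *)
rewrite -[LHS]inner_product_delta -inner_product_codeword mxE.
exact/eqP/x0/codeword_in.
Qed.

Lemma even_codeword u : ~~ odd (hamming_weight (codeword u)).
Proof.
have := self_orthogonal u u; rewrite inner_product_self.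
by move/(@natF2_inj _ false) => ->.
Qed.

(* Poisson summation over the coset [s + code]; [s = 0] gives MacWilliams'
   identity, and [s] in the shadow gives the shadow transform. *)
Lemma poisson_code s f :
  \sum_u chi (inner_product s (codeword u)) *
         krawtchouk f (m + m) (hamming_weight (codeword u)) =
  2 ^+ m * \sum_u nth 0 f (hamming_weight (s + codeword u)).
Proof.
under eq_bigr => u _ do rewrite -sum_chi_weight big_distrr.
rewrite exchange_big /= (reindex_inj (addrI s)) /=.
transitivity (\sum_(y in code) 2 ^+ m * nth 0 f (hamming_weight (s + y))).
  rewrite [RHS]big_mkcond; apply: eq_bigr => y _.
  (* After the shift the two occurrences of [s] cancel. What remains is the character of the
     syndrome of [y], whose sum over [u] is 2^m on the code and 0 elsewhere. *)
  under eq_bigr => u _.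
    rewrite mulrA -chiD (inner_productC (codeword u)) -inner_productDl.
    rewrite addrA add_rvv add0r inner_product_codeword; over.
  rewrite -big_distrl /= sum_chi orthogonal_code.
  by case: ifP; rewrite ?mul0r.
by rewrite big_code big_distrr.
Qed.

(** Both sides are additive in [u], the right one by [odd_half_weightD], so membership in the shadow
    needs checking on generators only. *)
Lemma shadow_character s :
  (forall i, inner_product s (codeword (delta_mx 0 i)) =
             (odd (hamming_weight (codeword (delta_mx 0 i)))./2)%:R) ->
  forall u, inner_product s (codeword u) = (odd (hamming_weight (codeword u))./2)%:R.
Proof.
move=> sP u; rewrite [u]row_sum_delta.
elim/big_ind: _ => [|x y IHx IHy|i _].
- by rewrite codeword0 hamming_weight0 inner_productC inner_product0l.
- rewrite codewordD inner_productDr IHx IHy -natF2_addb odd_half_weightD //.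
  + exact: even_codeword.
  + exact: even_codeword.
  + exact: self_orthogonal.
rewrite (F2_natE (u 0 i)); case: (u 0 i != 0); rewrite ?scale1r ?scale0r //.
by rewrite codeword0 hamming_weight0 inner_productC inner_product0l.
Qed.

End SystematicCode.

(** * The coefficients of weights 10 and 12 *)

Lemma sum_fiber (T : finType) (h : T -> nat) (f : nat -> Z) ws :
  uniq ws -> (forall u, h u \notin ws -> f (h u) = 0) ->
  \sum_u f (h u) = \sum_(w <- ws) f w * #|[set u | h u == w]|%:R.
Proof.
move=> uws f0.
transitivity (\sum_u \sum_(w <- ws | h u == w) f w).
  apply: eq_bigr => u _; have [uw|uw] := boolP (h u \in ws).
    rewrite big_mkcond (bigD1_seq _ uw uws) /= eqxx big1 ?addr0 // => w.
    by rewrite eq_sym => /negPf ->.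
  by rewrite f0 // big1_seq // => w /andP[/eqP <-]; rewrite (negPf uw).
rewrite (exchange_big_dep xpredT) //=; apply: eq_bigr => w _.
by rewrite sumr_const cardsE mulr_natr.
Qed.

(* Combining MacWilliams' identity, tested on [f], with the shadow identity,
   tested on [g], every codeword of weight [i] contributes [residual f g i].
   The lists below solve the linear system which makes this vanish for all even
   [i >= 14] and isolates one of the weights 10 and 12. *)
Definition residual (f g : seq Z) (i : nat) : Z :=
  2 ^+ 28 * nth 0 f i - krawtchouk f 56 i -
  (-1) ^+ odd i./2 * krawtchouk g 56 i.

Definition mac10 : seq Z :=
  [:: -289750396875866080; 0; -40452165797604680; 0; -45155906006628480; 0;
  940748041804760; 0; -3762992167219040; 0; 940748041804760; 0; 0; 0; 0; 0;
  -71254725824568; 0; 114340213818402; 0; -128434159949568; 0;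
  128555404172514; 0; -125176154670936; 0; 122632266920715; 0;
  -121796154519760; 0; 122632266920715; 0; -125176154670936; 0;
  128555404172514; 0; -128434159949568; 0; 114340213818402; 0;
  -71254725824568]%coqZ.

Definition sh10 : seq Z :=
  [:: 289750396875866080; 0; 0; 0; 45155906006628480; 0; 0; 0;
  3762992167219040]%coqZ.

Definition mac12 : seq Z :=
  [:: -375358468680099240; 0; -130952127419222592; 0; -28034291645781848; 0;
  -7525984334438080; 0; 188149608360952; 0; 0; 0; 94074804180476; 0; 0; 0;
  -46246322131698; 0; 70311311837136; 0; -78808420179918; 0; 79699638829680;
  0; -77847351123450; 0; 75865316474720; 0; -75068009721789; 0;
  75865316474720; 0; -77847351123450; 0; 79699638829680; 0; -78808420179918;
  0; 70311311837136; 0; -46246322131698]%coqZ.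

Definition sh12 : seq Z :=
  [:: -395114177557999200; 0; 0; 0; -33114331071527552; 0; 0; 0;
  -752598433443808]%coqZ.

(** The value at 0 is -308 times the value at 10, the source of the constant in A_10. The list
    [iota 7 22] covers the even weights from 14 to 56. *)
Lemma residual_mac10 :
  [/\ residual mac10 sh10 0 = (-77779279911554086579732480)%coqZ,
      residual mac10 sh10 10 = 252530129582967813570560%coqZ,
      residual mac10 sh10 12 = 0%coqZ
    & all (fun k => residual mac10 sh10 k.*2 == 0) (iota 7 22)].
Proof. by split; vm_compute. Qed.

(** Here the value at 0 is -3990 times the value at 12. *)
Lemma residual_mac12 :
  [/\ residual mac12 sh12 0 = (-100759521703604157614653440)%coqZ,
      residual mac12 sh12 10 = 0%coqZ,
      residual mac12 sh12 12 = 25253012958296781357056%coqZ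
    & all (fun k => residual mac12 sh12 k.*2 == 0) (iota 7 22)].
Proof. by split; vm_compute. Qed.

Lemma exp2_28 : 2 ^+ 28 = 268435456%coqZ :> Z.
Proof. by vm_compute. Qed.

Lemma natrZ k : k%:R = Z.of_nat k :> Z.
Proof. by elim: k => // k IH; rewrite -natr1 IH; lia. Qed.

Lemma hamming_weight_le n (x : 'rV['F_2]_n) : (hamming_weight x <= n)%N.
Proof. by rewrite -[X in (_ <= X)%N]card_ord max_card. Qed.

Section Length56.

Variable A : 'M['F_2]_28.
Hypothesis AAt : A *m A^T = 1%:M.

Let a w := #|[set u | hamming_weight (codeword A u) == w]|.

Hypothesis a_small : forall w, (0 < w <= 8)%N -> a w = 0%N.

Lemma codeword_weights u :
  [\/ hamming_weight (codeword A u) = 0%N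
    | exists2 k, (4 < k <= 28)%N & hamming_weight (codeword A u) = k.*2].
Proof.
set w := hamming_weight _.
have w56 : (w <= 56)%N by apply: hamming_weight_le.
have := even_halfK (even_codeword AAt u); rewrite -/w => ew.
have [w8|w9] := leqP w 8; last by right; exists w./2; lia.
left; apply/eqP; rewrite -leqn0 leqNgt; apply/negP => w0.
have /eqP := a_small (introT andP (conj w0 w8)).
by rewrite cards_eq0 => /eqP/setP/(_ u); rewrite !inE eqxx.
Qed.

Variable s : 'rV['F_2]_(28 + 28).
Hypothesis shadow_s : forall i,
  inner_product s (codeword A (delta_mx 0 i)) =
  (odd (hamming_weight (codeword A (delta_mx 0 i)))./2)%:R.

Let b w := #|[set u | hamming_weight (s + codeword A u) == w]|.

Hypothesis a0 : a 0%N = 1%N.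
Hypothesis b0 : b 0%N = 0%N.

(** Sum [residual f g] over all codewords. Poisson summation at 0 cancels the terms in [f]; at [s]
    it turns the term in [g] into a sum over the coset of [s], where only weights 4 and 8
    contribute. *)
Lemma residual_sum f g (g0 g4 g8 : Z) :
  g = [:: g0; 0; 0; 0; g4; 0; 0; 0; g8] ->
  all (fun k => residual f g k.*2 == 0) (iota 7 22) ->
  residual f g 0 + residual f g 10 * (a 10%N)%:R + residual f g 12 * (a 12%N)%:R =
  - 2 ^+ 28 * (g4 * (b 4%N)%:R + g8 * (b 8%N)%:R).
Proof.
move=> gE /allP res0.
have mac := poisson_code AAt 0 f; have sh := poisson_code AAt s g.
have -> : g4 * (b 4%N)%:R + g8 * (b 8%N)%:R =
          \sum_u nth 0 g (hamming_weight (s + codeword A u)).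
  rewrite (@sum_fiber _ _ (nth 0 g) [:: 0; 4; 8]%N) //.
    by rewrite !big_cons big_nil -!/(b _) b0 gE /= mulr0 add0r addr0.
  move=> u; rewrite gE !inE.
  by case: (hamming_weight _) => [|[|[|[|[|[|[|[|[|[]]]]]]]]]].
rewrite mulNr -sh.
transitivity (\sum_u residual f g (hamming_weight (codeword A u))).
  rewrite (@sum_fiber _ _ (residual f g) [:: 0; 10; 12]%N) //.
    by rewrite !big_cons big_nil -!/(a _) a0 mulr1 addr0 addrA.
  (* A nonzero codeword has weight 2k with 5 <= k <= 28; excluding weights 10 and 12 leaves k >= 7,
     where the residual vanishes. *)
  move=> u; have [-> //|[k k28 ->]] := codeword_weights u.
  rewrite !inE => k_neq; apply/eqP/res0; rewrite mem_iota.
  by move: k_neq k28; case: k => [|[|[|[|[|[|[]]]]]]] //; lia.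
rewrite /residual !sumrB -big_distrr /=.
have <- : 2 ^+ 28 * (\sum_u nth 0 f (hamming_weight (codeword A u))) =
  \sum_u krawtchouk f 56 (hamming_weight (codeword A u)).
  transitivity (2 ^+ 28 * (\sum_u nth 0 f (hamming_weight (0 + codeword A u)))).
    by congr (_ * _); apply: eq_bigr => u _; rewrite add0r.
  rewrite -mac; apply: eq_bigr => u _.
  by rewrite inner_product0l (chi_nat false) mul1r.
rewrite subrr sub0r; congr (- _); apply: eq_bigr => u _.
by rewrite (shadow_character AAt shadow_s) chi_nat.
Qed.

(** Dividing [residual_sum] by the residual at 10 leaves the coefficients 48 = 4 * 12 and 4 for
    [b 4] and [b 8]. *)
Lemma weight10 : (a 10 + 4 * (b 8 + 12 * b 4) = 308)%N.
Proof.
have [r0 r10 r12 res] := residual_mac10.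
have := residual_sum (erefl sh10) res; rewrite r0 r10 r12 !natrZ exp2_28; lia.
Qed.

(** Division by the residual at 12 gives the coefficients 352 = 256 + 8 * 12 and 8. *)
Lemma weight12 : (a 12 = 3990 + 256 * b 4 + 8 * (b 8 + 12 * b 4))%N.
Proof.
have [r0 r10 r12 res] := residual_mac12.
have := residual_sum (erefl sh12) res; rewrite r0 r10 r12 !natrZ exp2_28; lia.
Qed.

End Length56.
(** * Certified codes of length 56 *)

Definition transpose (rows : seq bitseq) : seq bitseq :=
  [seq [seq nth false r j | r <- rows] | j <- iota 0 28].

Definition zeros : bitseq := nseq 28 false.

(* A vector of weight at most 8 has weight at most 4 on the left half or at most
   3 on the right half; as A is orthogonal, both halves are information sets,
   with parity parts given by A and by its transpose. *)
Definition light_weights (rows : seq bitseq) (x : bitseq) : seq nat :=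
  let trows := transpose rows in
  [seq (p.1 + p.2)%N | p <- light rows x 0 4] ++
  [seq (p.1 + p.2)%N | p <- light trows (comb trows zeros x) 0 3 & (4 < p.2)%N].

(* [r] is a row of A; the generator (e_i | r) has weight 1 + wt r. *)
Definition half_parity (r : bitseq) : bool := odd (wt r).+1./2.

Definition well_formed (rows : seq bitseq) : bool :=
  ((size rows == 28) && all (fun r => size r == 28) rows)%N.

Definition orthogonal_rows (rows : seq bitseq) : bool :=
  [seq [seq dotw r r' | r' <- rows] | r <- rows] ==
  [seq [seq i == j | j <- iota 0 28] | i <- iota 0 28].

(* The right half of a shadow vector with left half 0. *)
Definition shadow_row (rows : seq bitseq) : bitseq :=
  comb rows zeros (map half_parity rows).

Definition has_shadow_weights (b4 b8 : nat) (rows : seq bitseq) : bool :=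
  let x := shadow_row rows in let ws := light_weights rows x in
  [&& all (fun r => dotw x r == half_parity r) rows, count_mem 0%N ws == 0%N,
      count_mem 4%N ws == b4 & count_mem 8%N ws == b8].

(** The third test provides a generator of weight 2 mod 4, hence a singly-even code; the fourth says
    that 0 is the only codeword of weight at most 8. *)
Definition certified (b4 b8 : nat) (rows : seq bitseq) : bool :=
  [&& well_formed rows, orthogonal_rows rows, has half_parity rows,
      light_weights rows zeros == [:: 0%N] & has_shadow_weights b4 b8 rows].

(* Least significant bit first. *)
Fixpoint bits (k : nat) (x : N) : bitseq :=
  if k is k'.+1 then N.odd x :: bits k' (N.div2 x) else [::].

(** * Soundness of the boolean checks *)

Lemma mx_transpose rows : size rows = 28%N ->
  rows_mx 28 28 (transpose rows) = (rows_mx 28 28 rows)^T.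
Proof.
move=> srows; apply/matrixP => i j; rewrite !mxE (nth_map 0%N) ?size_iota //.
by rewrite (nth_map [::]) ?srows // nth_iota.
Qed.

Lemma well_formed_transpose rows : size rows = 28%N ->
  well_formed (transpose rows).
Proof.
move=> srows; apply/andP; split; first by rewrite size_map size_iota.
by apply/allP => _ /mapP[j _ ->]; rewrite size_map srows.
Qed.

Lemma rv_zeros : rv 28 zeros = 0.
Proof. by apply/rowP => i; rewrite !mxE nth_nseq ltn_ord. Qed.

Lemma orthogonal_rowsP rows : well_formed rows -> orthogonal_rows rows ->
  rows_mx 28 28 rows *m (rows_mx 28 28 rows)^T = 1%:M.
Proof.
case/andP=> /eqP srows /allP wrows /eqP orows; apply/matrixP => i j.
have rowE (k : 'I_28) : row k (rows_mx 28 28 rows) = rv 28 (nth [::] rows k).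
  by apply/rowP => l; rewrite !mxE.
have size_row (k : 'I_28) : size (nth [::] rows k) = 28%N.
  by apply/eqP/wrows/mem_nth; rewrite srows.
transitivity (inner_product (row i (rows_mx 28 28 rows)) (row j (rows_mx 28 28 rows))).
  by rewrite mxE; apply: eq_bigr => k _; rewrite !mxE.
rewrite !rowE inner_product_rv // mxE -val_eqE /=; congr (nat_of_bool _)%:R.
have := congr1 (fun s => nth false (nth [::] s i) j) orows.
rewrite (nth_map [::]) ?srows // (nth_map [::]) ?srows // => ->.
by rewrite (nth_map 0%N) ?size_iota // (nth_map 0%N) ?size_iota // !nth_iota.
Qed.

(** The predicate [P] accommodates the filter on the second weight in [light_weights]; [w <= 8]
    makes the cutoff of the enumeration harmless. *)
Lemma count_light rows x t w (P : pred nat) :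
  well_formed rows -> size x = 28%N -> (t <= 8)%N -> (w <= 8)%N ->
  count (fun p => (p.1 + p.2 == w)%N && P p.2) (light rows x 0 t) =
  #|[set u | [&& hamming_weight u <= t,
       hamming_weight u + hamming_weight (rv 28 x + u *m rows_mx 28 28 rows) == w
     & P (hamming_weight (rv 28 x + u *m rows_mx 28 28 rows))]%N]|.
Proof.
case/andP=> /eqP srows wrows sx t8 w8.
rewrite lightE ?add0n // count_map count_filter card_rv srows.
apply: eq_in_count => u; rewrite mem_words => /eqP su /=.
rewrite -rv_comb // !hamming_weight_rv ?(size_comb _ wrows) // add0n.
by case: (wt u <= t)%N; rewrite ?andbF //= andbAC; case: eqP => //= ->; rewrite w8.
Qed.

(** The two lists in [light_weights] separate the vectors with left weight at most 4 from the
    others, so nothing is counted twice. *)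
Lemma count_light_weights rows x w :
  well_formed rows -> orthogonal_rows rows -> size x = 28%N -> (w <= 8)%N ->
  count_mem w (light_weights rows x) =
  #|[set u | hamming_weight (row_mx 0 (rv 28 x) + codeword (rows_mx 28 28 rows) u) == w]|.
Proof.
move=> wrows orows sx w8; have AAt := orthogonal_rowsP wrows orows.
have /andP[/eqP srows _] := wrows; have wtrows := well_formed_transpose srows.
have sy : size (comb (transpose rows) zeros x) = 28%N.
  by apply: size_comb; case/andP: wtrows.
rewrite /light_weights count_cat !count_map count_filter.
rewrite (eq_count (a2 := fun p => (p.1 + p.2 == w)%N && true)); last first.
  by move=> p; rewrite /= andbT.
rewrite (count_light xpredT) // (count_light (fun k => 4 < k)%N) //.
have /andP[/eqP strows atrows] := wtrows.
rewrite (@rv_comb 28) ?rv_zeros ?add0r ?mx_transpose //.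
set A := rows_mx 28 28 rows; set y := rv 28 x.
rewrite -(cardsID [set u | hamming_weight u <= 4]%N [set u | _ == w]).
have weightE u : hamming_weight (row_mx 0 y + codeword A u) =
    (hamming_weight u + hamming_weight (y + u *m A))%N.
  by rewrite add_row_mx add0r hamming_weight_row.
congr (_ + _)%N; first by apply: eq_card => u; rewrite !inE weightE andbT andbC.
(* The second list is indexed by the right half v = y + u A, and this map recovers the left half u
   from it. *)
rewrite -(card_imset _ (f := fun v => (y + v) *m A^T)); last first.
  move=> v v' /(congr1 (mulmx^~ A)); rewrite -!mulmxA !(mulmx1C AAt) !mulmx1.
  exact: addrI.
apply: eq_card => u; rewrite !inE weightE -ltnNge.
apply/imsetP/andP => [[v]|[u4 /eqP uw]].
  rewrite inE -mulmxDl => /and3P[_ /eqP vw v4] ->; split=> //.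
  by rewrite -mulmxA (mulmx1C AAt) mulmx1 addrA add_rvv add0r addnC vw.
have invu : (y + (y + u *m A)) *m A^T = u.
  by rewrite addrA add_rvv add0r -mulmxA AAt mulmx1.
exists (y + u *m A); last by rewrite invu.
rewrite inE -mulmxDl invu u4 addnC uw eqxx !andbT.
(* Total weight at most 8 with left weight above 4 leaves at most 3 on the right. *)
by move: (hamming_weight u) (hamming_weight (y + _)) u4 uw w8 => h k; lia.
Qed.

(** * From a certificate to a code with known enumerator *)

Lemma take_weight_enumerator (C : {vspace 'rV['F_2]_56}) (c10 c12 : int) :
  weight_count C 0 = 1%N ->
  (forall w, (w < 13)%N -> w \notin [:: 0; 10; 12]%N -> weight_count C w = 0%N) ->
  (weight_count C 10)%:R = c10 -> (weight_count C 12)%:R = c12 ->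
  take_poly 13 (weight_enumerator C) = 1 + c10 *: 'X^10 + c12 *: 'X^12.
Proof.
move=> C0 Csmall <- <-; apply/polyP => i.
rewrite coef_take_poly /weight_enumerator -(poly_def _ (fun i => (weight_count C i)%:R)).
rewrite coef_poly !coefD !coefZ !coefXn coef1.
have [i13|i13] := ltnP i 13; last first.
  by do 13 (case: i i13 => // i i13); rewrite !mulr0 !addr0.
rewrite ifT; last exact: leq_trans i13 _.
have := Csmall i i13; rewrite !inE.
case: eqP => [-> _|_]; first by rewrite C0 !mulr0 !addr0.
case: eqP => [-> _|_]; first by rewrite mulr1 mulr0 addr0 add0r.
case: eqP => [-> _|_ ->//]; first by rewrite mulr1 mulr0 !add0r.
by rewrite !mulr0 !addr0.
Qed.

Lemma codeword_delta m rows (i : 'I_m) :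
  codeword (rows_mx m m rows) (delta_mx 0 i) =
  row_mx (delta_mx 0 i) (rv m (nth [::] rows i)).
Proof.
by rewrite /codeword -rowE; congr row_mx; apply/rowP => j; rewrite !mxE.
Qed.

Lemma hamming_weight_generator rows (i : 'I_28) : well_formed rows ->
  hamming_weight (codeword (rows_mx 28 28 rows) (delta_mx 0 i)) =
  (wt (nth [::] rows i)).+1.
Proof.
case/andP=> /eqP srows /allP wrows; rewrite codeword_delta hamming_weight_row.
rewrite hamming_weight_delta hamming_weight_rv ?add1n //.
by apply/eqP/wrows/mem_nth; rewrite srows.
Qed.

(** The bound 77 = 308/4 makes A_10 positive, so the minimum distance is exactly 10. *)
Lemma certified_code b4 b8 rows :
  certified b4 b8 rows -> (b8 + 12 * b4 < 77)%N ->
  exists C : {vspace 'rV['F_2]_56},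
    [/\ is_code 28%N 10%N C, self_dual C, singly_even C &
        take_poly 13 (weight_enumerator C) =
        1 + (308 + 4 * - (b8 + 12 * b4)%N%:Z) *: 'X^10
          + (3990 + 256 * b4%:Z - 8 * - (b8 + 12 * b4)%N%:Z) *: 'X^12].
Proof.
case/and5P=> wrows orows hrows /eqP light0 /and4P[/allP hpar /eqP s0 /eqP s4 /eqP s8] b77.
have /andP[/eqP srows /allP srow] := wrows.
set A := rows_mx 28 28 rows; have AAt : A *m A^T = 1%:M := orthogonal_rowsP wrows orows.
set x := shadow_row rows in hpar s0 s4 s8.
have sx : size x = 28%N by apply: size_comb; first by case/andP: wrows.
set s : 'rV_(28 + 28) := row_mx 0 (rv 28 x).
have size_row (i : 'I_28) : size (nth [::] rows i) = 28%N.
  by apply/eqP/srow/mem_nth; rewrite srows.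
have sP i : inner_product s (codeword A (delta_mx 0 i)) =
    (odd (hamming_weight (codeword A (delta_mx 0 i)))./2)%:R.
  rewrite hamming_weight_generator // codeword_delta inner_product_row.
  rewrite inner_product0l add0r inner_product_rv //.
  by rewrite (eqP (hpar _ _)) // mem_nth ?srows.
have codeE w : (w <= 8)%N ->
    #|[set u | hamming_weight (codeword A u) == w]| = (w == 0)%N.
  move=> w8; transitivity (count_mem w (light_weights rows zeros)).
    rewrite count_light_weights // rv_zeros row_mx0.
    by apply: eq_card => u; rewrite !inE add0r.
  by rewrite light0 /= addn0 eq_sym.
have a0 : #|[set u | hamming_weight (codeword A u) == 0%N]| = 1%N by rewrite codeE.
have asmall w : (0 < w <= 8)%N -> #|[set u | hamming_weight (codeword A u) == w]| = 0%N.
  by case/andP=> w0 w8; rewrite codeE // eqn0Ngt w0.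
have shadowE w : (w <= 8)%N ->
    #|[set u | hamming_weight (s + codeword A u) == w]| =
    count_mem w (light_weights rows x).
  by move=> w8; rewrite count_light_weights.
have b0 : #|[set u | hamming_weight (s + codeword A u) == 0%N]| = 0%N.
  by rewrite shadowE.
have a10 := weight10 AAt asmall sP a0 b0.
have a12 := weight12 AAt asmall sP a0 b0.
rewrite !shadowE // s4 s8 in a10 a12.
set C : {vspace 'rV['F_2]_56} := code A.
have countE w : weight_count C w =
    #|[set u | hamming_weight (codeword A u) == w]| := weight_count_code A w.
exists C; split.
- split; first exact: (dim_code A).
  split; last first.
    move=> u v uC vC uv; rewrite hamming_distE.
    have /mem_codeP[z zE] : u + v \in code A by rewrite memvD.
    (* A nonzero codeword has even weight 2k with k > 4, hence at least 10. *)
    rewrite zE; have [z0|[k k4 ->]] := codeword_weights AAt asmall z; last by lia.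
    have /eqP := z0; rewrite hamming_weight_eq0 -zE addr_eq0 opp_rv => /eqP uv_eq.
    by rewrite uv_eq eqxx in uv.
  have /card_gt0P[u] : (0 < #|[set u | hamming_weight (codeword A u) == 10%N]|)%N by lia.
  rewrite inE => /eqP u10; exists (codeword A u), 0; split.
  + exact: (codeword_in A u).
  + exact: mem0v.
  + by rewrite -hamming_weight_eq0 u10.
  + by rewrite hamming_distE addr0.
- exact: (self_dual_code AAt).
- have /(has_nthP [::])[i i28 iodd] := hrows.
  rewrite srows in i28; exists (codeword A (delta_mx 0 (Ordinal i28))).
    exact: (codeword_in A).
  rewrite hamming_weight_generator //=; move: iodd; rewrite /half_parity; lia.
- apply: take_weight_enumerator.
  + by rewrite countE.
  + move=> w w13; rewrite !inE !negb_or => /and3P[w0 w10 w12].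
    rewrite countE; apply/eqP; rewrite cards_eq0; apply/eqP/setP => u.
    rewrite !inE; apply/negbTE.
    have [-> |[k k4 ->]] := codeword_weights AAt asmall u; lia.
  + by rewrite countE; lia.
  + by rewrite countE; lia.
Qed.

(** * The codes *)

(* Pairs of z = - alpha and the 28 rows of A, coded in binary. *)
Definition codes_W1 : seq (nat * seq N) := [::
  (13%N, [::
    245071454; 145056750; 185348775; 71506882; 205111210; 178593786;
    45036575; 215734861; 258211711; 1014452; 49170259; 266784923; 24753617;
    205964866; 24313114; 150914708; 70953406; 60568017; 205517351; 174874835;
    94810301; 7003999; 107597141; 219932876; 1972066; 40866812; 27474984;
    69740384]%num);
  (15%N, [::
    196665537; 226950513; 205537222; 51320480; 152707381; 233378456;
    126659203; 246696371; 137359902; 1014452; 94521906; 145415674; 24753618;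
    185256736; 104788088; 150914708; 58107100; 60568018; 152857787;
    220229042; 94810302; 88687043; 107597142; 259291953; 87919101; 27474984;
    122424672; 69740384]%num);
  (17%N, [::
    136091419; 155930515; 85370652; 237825432; 266599478; 98128872;
    112723141; 194435579; 26624659; 123307836; 179804375; 83197842; 57373444;
    19010276; 184680126; 152134092; 52244089; 78228863; 167247017; 202264043;
    174947726; 228987922; 146313970; 85323191; 7137984; 53891170; 170623956;
    185130624]%num);
  (20%N, [::
    107340406; 85664859; 262390879; 205253828; 204073897; 268361756;
    123453918; 80696647; 261075363; 236238247; 227919830; 212890152;
    226449453; 56660572; 200143498; 110962108; 257910608; 262220357;
    65115899; 169472965; 76181336; 86223054; 149114297; 34558622; 208128794;
    86556760; 132201520; 6743344]%num);
  (35%N, [::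
    150743523; 123094480; 88734358; 242113906; 60539147; 114236972;
    113070814; 103211279; 193543781; 7701433; 77982155; 209297254; 142811391;
    124851796; 192241397; 130303755; 207286433; 40815855; 126207804;
    52775339; 188420373; 229937296; 205443566; 53281660; 194834250; 27874918;
    202972888; 200997568]%num);
  (36%N, [::
    152578275; 162011721; 177148355; 9657207; 127662714; 221111723; 67757705;
    77646131; 179013422; 168374486; 211185976; 184404621; 181004129;
    224561605; 196723021; 27159826; 102975627; 99163036; 199405994;
    258706306; 97395142; 110215747; 86180974; 81615943; 94896613; 203794258;
    84145412; 224786460]%num);
  (37%N, [::
    153664895; 129606933; 239792485; 78738412; 95717870; 24923955; 26581404;
    204502126; 114300239; 43075903; 154816248; 101975514; 224662437;
    12841649; 201784859; 5217526; 17802502; 126014560; 79533360; 37911748;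
    16405142; 121397353; 216443899; 80210887; 249018517; 179205883;
    253954937; 213317086]%num);
  (39%N, [::
    31419873; 111433665; 51135119; 245405751; 127418606; 155201806;
    260829387; 250895661; 112598795; 12773580; 89495548; 121275206;
    221480888; 103652533; 227944394; 228854693; 116937916; 163534673;
    238186328; 233832691; 204253672; 228980845; 149855514; 100367871;
    192533580; 73271616; 24877173; 201166625]%num);
  (41%N, [::
    82847406; 86531265; 11672506; 210904183; 115234281; 222603763; 129097713;
    25785845; 82355527; 77821006; 108551150; 20769773; 204952829; 264869500;
    166973724; 232140999; 42943552; 18032104; 97834015; 38288747; 29347883;
    11354869; 225508348; 157576067; 195628767; 250694782; 255949824; 74324687]%num);
  (42%N, [::
    84970707; 165491697; 157380088; 216092829; 206775289; 75100847; 96147091;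
    134556524; 201563677; 140449378; 88858623; 95072564; 204961751;
    158309485; 261777293; 8948133; 128875119; 238004532; 233271747;
    195332846; 68663843; 179440785; 173265173; 133704420; 162542492;
    262717000; 781766; 118388496]%num);
  (43%N, [::
    201287310; 234302782; 96340648; 68898087; 251272810; 25026125; 77682796;
    248953253; 31773954; 125602789; 11042454; 198699688; 144543369; 85850175;
    5746687; 216426702; 97559053; 218420730; 211958040; 56894983; 207387462;
    208828212; 133937033; 5524449; 34594914; 34843378; 103370318; 131216732]%num);
  (44%N, [::
    82689652; 133225306; 190851404; 68264967; 158950233; 84635770; 44527233;
    116725038; 240790444; 148191543; 213563073; 200083; 142822063; 65375222;
    55766891; 189905493; 138295870; 156933121; 5745772; 41569382; 126453072;
    225419648; 3457838; 177059307; 221674837; 21797612; 96624789; 139383220]%num);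
  (46%N, [::
    253412348; 28471682; 248849806; 104158851; 77055774; 258134455;
    245799739; 227906855; 266987321; 194601867; 213016247; 134902002;
    261723338; 231568395; 227969640; 55207043; 89304165; 119974110;
    125801693; 150002702; 151577432; 128480340; 96358091; 191678161;
    76409564; 96725423; 85793449; 82561088]%num);
  (48%N, [::
    185961807; 185535191; 186288039; 128421208; 124488432; 131303336;
    122269516; 127094481; 119971746; 98970482; 99141356; 99687833; 242312191;
    247879167; 245938687; 252524188; 253390129; 253024874; 25915981;
    20116627; 21362982; 48088742; 46079245; 41855571; 31715384; 14684159;
    150966215; 182682048]%num);
  (52%N, [::
    38151026; 76072172; 19995033; 232685015; 196934631; 243103695; 59216278;
    103522661; 89374923; 22901558; 43938925; 71104667; 74393150; 31116349;
    45455931; 131391883; 128799062; 125448421; 260556992; 254514048;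
    257140032; 256805153; 261718602; 255263892; 130713301; 129076643;
    124193614; 2096696]%num)].

Definition codes_W2 : seq (nat * seq N) := [::
  (1%N, [::
    60773427; 34944045; 134821077; 45419024; 109012778; 207756241; 119428542;
    74495997; 176107578; 240566785; 150829389; 258044772; 233647160;
    23351146; 36421776; 177453008; 211481960; 79248291; 120484482; 87402105;
    47742837; 139998950; 133404325; 250093882; 17563055; 256054509;
    231324327; 1860677]%num);
  (3%N, [::
    139507907; 244417490; 201527697; 80451690; 223176751; 54497342; 92098711;
    13360855; 32132120; 32393056; 66944546; 239682036; 177549104; 171199741;
    72993905; 247219626; 202200616; 26835094; 110302416; 208385384;
    103759907; 44378387; 192065182; 131228470; 46053909; 166943308; 82910357;
    222048942]%num);
  (33%N, [::
    262169001; 93767086; 78636488; 79930435; 73994229; 47585677; 242249099;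
    17623700; 215263906; 29576454; 76047531; 51124982; 152698372; 90342430;
    196651984; 93042732; 20908413; 174274112; 129597685; 47886671; 112370547;
    205603474; 21429777; 222729287; 166836234; 11595258; 164244305; 217743514]%num);
  (36%N, [::
    226842173; 25169437; 215770959; 170731912; 169068025; 161058092;
    228719048; 146594344; 7787818; 33106626; 187481876; 71774794; 185814751;
    32980244; 241505721; 79985904; 249643790; 35290547; 1868774; 196644312;
    124752969; 180963339; 98292552; 180309730; 244735874; 81643572; 44594756;
    4422272]%num);
  (37%N, [::
    239587426; 114314516; 172926431; 206936256; 232661589; 124385485;
    168109150; 38311851; 250968564; 153281809; 260339511; 67496591;
    194131379; 35673437; 58359757; 9524615; 255214324; 265944568; 4167319;
    52549883; 25923957; 55940876; 145235304; 158546431; 149484605; 155568187;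
    267289710; 187766500]%num);
  (39%N, [::
    206734922; 118970234; 1343184; 243054377; 40704666; 120405501; 181499887;
    220930792; 209966473; 76794806; 43734801; 199415294; 104132637;
    109453021; 15419933; 64546467; 8332147; 183974360; 40470504; 147361448;
    109658713; 121568535; 265396705; 234592092; 154020432; 134963576;
    193310454; 60044350]%num);
  (41%N, [::
    25370821; 234500888; 32596186; 189936258; 133356580; 17101401; 249381621;
    169689202; 900376; 57776941; 129940986; 107590199; 206684385; 228215418;
    224201194; 20904702; 204865882; 64803155; 102806458; 246232679;
    235029431; 4179511; 105484537; 78961776; 164263135; 199032577; 141655864;
    97561292]%num);
  (43%N, [::
    227715014; 188331899; 227408005; 98933926; 110651891; 4659797; 75882780;
    19616308; 38974508; 162081406; 214426499; 163030781; 55091678; 109916747;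
    115407789; 38498587; 122187021; 50293526; 31902527; 73150721; 27025922;
    260300131; 160830645; 166350574; 64659263; 63369152; 91174912; 112580608]%num);
  (44%N, [::
    251005576; 240899928; 205295720; 253385342; 73164207; 231272989;
    177531102; 23430255; 144679181; 184046629; 183777350; 51355543; 36217891;
    162450369; 191229842; 109992762; 225470395; 76608185; 125530836;
    131527092; 128840548; 201294723; 108084808; 31687556; 52396144; 44772056;
    46503784; 35421184]%num);
  (45%N, [::
    75247300; 31215489; 45883202; 199694203; 250260734; 233950141; 161202253;
    171413651; 206545190; 13943247; 11342295; 8004071; 264559878; 262748741;
    259155587; 48161289; 79549458; 25114660; 108413752; 97293432; 62466232;
    99786516; 65384033; 116084362; 53101970; 105945444; 92611273; 133955584]%num);
  (46%N, [::
    174938050; 80064679; 162850657; 237204338; 44135999; 193066409;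
    255916308; 219303420; 160934924; 227787334; 54006659; 239837477;
    189486646; 24196539; 220586893; 95909619; 210597149; 247887086;
    236637411; 6631141; 94731750; 126082391; 229575545; 166312234; 136283911;
    133957624; 91174912; 112580608]%num);
  (47%N, [::
    56816424; 47539824; 61492449; 55877058; 45693828; 178833602; 188847492;
    177416968; 187060784; 173810785; 224877584; 215890945; 229439490;
    223998980; 213117960; 81628876; 95132088; 89633617; 79651491; 91145574;
    150264377; 166278259; 164817095; 162878862; 159002396; 202343423;
    33522656; 200310752]%num);
  (48%N, [::
    240631802; 54114175; 239657145; 233151650; 90010063; 138877521;
    255916324; 183388684; 160934932; 162081406; 117636027; 163030781;
    143505894; 109916747; 220586901; 38498587; 210597173; 154825518;
    166120251; 127478077; 39418430; 126082407; 173214857; 170874578;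
    136283911; 63369152; 91174912; 112580608]%num);
  (49%N, [::
    26069968; 52144350; 102198850; 202302330; 138262794; 8090260; 14083496;
    237234257; 227384541; 181482821; 71853813; 159023509; 52392107;
    133485143; 32125827; 37622791; 95837071; 178701471; 76004031; 149227135;
    123826556; 247635206; 228932108; 191509656; 116664752; 231232480;
    196122814; 16382]%num)].

(** Since z = b8 + 12 b4, the expected b8 is z - 12 b4; the first test makes this subtraction
    exact. *)
Definition certified_entry (b4 : nat) (p : nat * seq N) : bool :=
  [&& 12 * b4 <= p.1, p.1 < 77
    & certified b4 (p.1 - 12 * b4) (map (bits 28) p.2)]%N.

Lemma certified_W1 : all (certified_entry 1) codes_W1.
Proof. by vm_compute. Qed.

Lemma certified_W2 : all (certified_entry 0) codes_W2.
Proof. by vm_compute. Qed.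

Lemma certified_entry_code b4 codes z :
  all (certified_entry b4) codes -> z \in [seq p.1%:Z | p <- codes] ->
  exists C : {vspace 'rV['F_2]_56},
    [/\ is_code 28%N 10%N C, self_dual C, singly_even C &
        take_poly 13 (weight_enumerator C) =
        1 + (308 + 4 * - z) *: 'X^10
          + (3990 + 256 * b4%:Z - 8 * - z) *: 'X^12].
Proof.
move=> /allP codesP /mapP[p /codesP/and3P[p12 p77 cert] ->].
have := certified_code cert; rewrite subnK //; exact.
Qed.

Theorem mainTheorem2 :
  (forall alpha : int,
     alpha \in [seq - z | z <- [:: 13; 15; 17; 20; 35; 36; 37; 39; 41; 42; 43;
                                   44; 46; 48; 52] : seq int] ->
     exists C : {vspace 'rV['F_2]_56},
       [/\ is_code 28%N 10%N C, self_dual C, singly_even C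
         & W56_1_form alpha (weight_enumerator C)]) /\
  (forall alpha : int,
     alpha \in [seq - z | z <- [:: 1; 3; 33; 36; 37; 39; 41; 43; 44; 45; 46;
                                   47; 48; 49] : seq int] ->
     exists C : {vspace 'rV['F_2]_56},
       [/\ is_code 28%N 10%N C, self_dual C, singly_even C
         & W56_2_form alpha (weight_enumerator C)]).
Proof.
split=> _ /mapP[z z_in ->].
  (* With b4 = 1 the constant 3990 + 256 evaluates to 4246. *)
  exact: (certified_entry_code certified_W1 z_in).
exact: (certified_entry_code certified_W2 z_in).
Qed.
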